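(* Let $p>0$, let $(X,\|\cdot\|)$ be a normed space, and let $\alpha_i\in\mathbb{R}$ for $i\ge1$. The generalized triangle inequality $$\Big\|\sum_{i\ge1}x_i\Big\|^p\le\sum_{i\ge1}\alpha_i\|x_i\|^p$$ holds (for all sequences $(x_i)_{i\ge1}\subset X$ with $\sum_{i\ge1}\|x_i\|<\infty$) if and only if: - in the case $p>1$: $\alpha_i>0$ for all $i\ge1$ and $\sum_{i\ge1}\alpha_i^{\frac{1}{1-p}}\le1$; - in the case $0<p\le1$: $\alpha_i\ge1$ for all $i\ge1$.
   Context: The $\alpha_i$ are fixed real coefficients, and the inequality is considered for sequences $(x_i)_{i\ge1}$ in the normed space $X$ whose norms are summable. *)

(* Defs.v *)
From HB Require Import structures.
From mathcomp Require Import all_boot all_order all_algebra.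
From mathcomp Require Import all_classical all_reals all_analysis.

Set Implicit Arguments.
Unset Strict Implicit.
Unset Printing Implicit Defensive.

Import Order.TTheory GRing.Theory Num.Theory.
Import numFieldNormedType.Exports.

Local Open Scope classical_set_scope.
Local Open Scope ring_scope.

(* The norm of the sum of the x_i. The space X need not be complete, so
   [limn (series x)] may fail to exist in X even when the norms are summable;
   the partial sums are then still Cauchy, and the limit of their norms is the
   norm of the sum taken in the completion of X. When the series converges
   in X, this is the norm of its sum (lemma [norm_sumE]). *)
Definition norm_sum (R : realType) (X : normedModType R) (x : X^nat) : R :=
  limn (fun n => `|series x n|).

Lemma norm_sumE (R : realType) (X : normedModType R) (x : X^nat) :
  cvgn (series x) -> norm_sum x = `|limn (series x)|.
Proof. by move=> cx; apply: cvg_lim => //; exact: cvg_norm. Qed.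

Lemma is_cvg_norm_sum (R : realType) (X : normedModType R) (x : X^nat) :
  cvgn [normed series x] -> cvgn (fun n => `|series x n|).
Proof.
move=> cx; pose a : R^nat := fun n => `|series x n|.
have ctel : cvgn (series (telescope a)).
  apply: normed_cvg.
  apply: (series_le_cvg _ _ _ cx) => n //=.
  rewrite /telescope /a (le_trans (ler_dist_dist _ _))//.
  by rewrite seriesSB.
have aE : a = series (telescope a) \+ cst (a 0%N).
  by apply/funext => n /=; rewrite telescopeK subrK.
by rewrite -/a aE; apply: is_cvgD => //; exact: is_cvg_cst.
Qed.

(* The right-hand side is read in the extended reals (for p < 1 it can be +oo).
   Coefficients of mixed signs could make it oscillate, hence the explicit
   requirement that it has a limit. Indices start at 0 instead of 1. *)
Definition generalized_triangle_inequality (R : realType) (X : normedModType R)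
    (p : R) (alpha : R^nat) : Prop :=
  forall x : X^nat, cvgn [normed series x] ->
    cvgn (fun n => \sum_(0 <= i < n) (alpha i * `|x i| `^ p)%:E)%E /\
    ((norm_sum x `^ p)%:E <=
       \sum_(0 <= i <oo) (alpha i * `|x i| `^ p)%:E)%E.
Arguments generalized_triangle_inequality {R} X p alpha.

(* Main.v *)
(* Feeding [x i = t i *: v] with [v] a unit vector into the inequality, and
   conversely bounding [`|\sum x i|] by [\sum `|x i|], shows that it is
   equivalent to [(\sum t i) `^ p <= \sum alpha i * t i `^ p] for all finite
   nonnegative families [t]. A single nonzero [t i] forces [1 <= alpha i], which
   suffices when [p <= 1] because [powR] is then subadditive. When [p > 1],
   [t i = alpha i `^ (1 / (1 - p))], the equality case of Hoelder's inequality,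
   gives necessity, and Hoelder's inequality itself gives sufficiency. *)
Require Import Defs.
From HB Require Import structures.
From mathcomp Require Import all_boot all_order all_algebra.
From mathcomp Require Import all_classical all_reals all_analysis.
From mathcomp Require Import ring lra.

Import Order.TTheory GRing.Theory Num.Theory.
Import numFieldNormedType.Exports.

Local Open Scope classical_set_scope.
Local Open Scope ring_scope.

(** Young's inequality for the product [t * 1] with conjugate exponents [p] and [p / (p - 1)],
    multiplied by [p]. *)
Lemma bernoulli_powR (R : realType) (p t : R) :
  1 < p -> 0 <= t -> 1 + p * (t - 1) <= t `^ p.
Proof.
move=> p1 t0; have p0 : 0 < p by lra.
have q0 : 0 < p / (p - 1) by rewrite divr_gt0 ?subr_gt0.
have pq : p^-1 + (p / (p - 1))^-1 = 1.
  by field; rewrite subr_eq0 !gt_eqF.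
have := conjugate_powR t0 ler01 p0 q0 pq.
rewrite mulr1 powR1 => young.
have -> : 1 + p * (t - 1) = p * (t - 1 / (p / (p - 1))).
  by field; rewrite subr_eq0 !gt_eqF.
by rewrite mulrC -ler_pdivlMr// lerBlDr.
Qed.

(** A form of Hoelder's inequality, meant for [b i = alpha i]^ (1 / (1 - p))[, so that]b i
    [^ (1 - p)] is [alpha i]. *)
Lemma powR_sum_weighted_le (R : realType) (p : R) (n : nat) (b t : R^nat) :
  1 < p -> (forall i, 0 < b i) -> \sum_(0 <= i < n) b i <= 1 ->
  (forall i, 0 <= t i) ->
  (\sum_(0 <= i < n) t i) `^ p <= \sum_(0 <= i < n) b i `^ (1 - p) * t i `^ p.
Proof.
move=> p1 b0 b1 t0; set s := \sum_(0 <= i < n) t i.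
have s_ge0 : 0 <= s by apply: sumr_ge0.
have [s0|sN0] := eqVneq s 0.
  rewrite s0 powR0 ?gt_eqF ?(lt_trans ltr01)//.
  by apply: sumr_ge0 => i _; rewrite mulr_ge0 ?powR_ge0.
have s_gt0 : 0 < s by rewrite lt_def sN0.
(* Bernoulli applied to [t i / (b i * s)]; its linear terms sum to
   [1 + (p - 1) * (1 - \sum_i b i) >= 1]. *)
apply: (@le_trans _ _
  (\sum_(0 <= i < n) s `^ p * ((1 - p) * b i + p / s * t i))).
  rewrite -mulr_sumr big_split/= -!mulr_sumr -/s divfK//.
  rewrite ler_peMr ?powR_ge0//.
  have : 0 <= (p - 1) * (1 - \sum_(0 <= i < n) b i).
    by rewrite mulr_ge0 ?subr_ge0// ltW.
  lra.
apply: ler_sum => i _.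
have bs0 : 0 < b i * s by rewrite mulr_gt0.
have u0 : 0 <= t i / (b i * s) by rewrite divr_ge0// ltW.
have -> : b i `^ (1 - p) * t i `^ p
    = s `^ p * (b i * (t i / (b i * s)) `^ p).
  have {1}-> : t i = t i / (b i * s) * (b i * s) by rewrite divfK// lt0r_neq0.
  rewrite (powRM _ u0 (ltW bs0)) (powRM _ (ltW (b0 i)) s_ge0).
  have bE : b i `^ (1 - p) * b i `^ p = b i.
    by rewrite -powRD ?subrK ?powRr1 ?ltW// (lt0r_neq0 (b0 i)) implybT.
  by rewrite mulrCA [X in _ * X]mulrA bE; ring.
rewrite ler_wpM2l ?powR_ge0//.
have -> : (1 - p) * b i + p / s * t i = b i * (1 + p * (t i / (b i * s) - 1)).
  by field; rewrite sN0 lt0r_neq0.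
by rewrite ler_wpM2l ?bernoulli_powR// ltW.
Qed.

Lemma powR_sum_le (R : realType) (p : R) (n : nat) (t : R^nat) :
  0 < p -> p <= 1 -> (forall i, 0 <= t i) ->
  (\sum_(0 <= i < n) t i) `^ p <= \sum_(0 <= i < n) t i `^ p.
Proof.
move=> p0 p1 t0; set s := \sum_(0 <= i < n) t i.
have s_ge0 : 0 <= s by apply: sumr_ge0.
have [s0|sN0] := eqVneq s 0.
  rewrite s0 powR0 ?gt_eqF//.
  by apply: sumr_ge0 => i _; rewrite powR_ge0.
have s_gt0 : 0 < s by rewrite lt_def sN0.
(* [t i / s] lies in [0, 1], where [x <= x `^ p]. *)
have -> : s `^ p = \sum_(0 <= i < n) s `^ p * (t i / s).
  by rewrite -mulr_sumr -mulr_suml -/s divff// mulr1.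
rewrite !big_mkord; apply: ler_sum => i _.
rewrite -{2}(divfK sN0 (t i)) [X in _ <= X `^ _]mulrC.
rewrite powRM ?divr_ge0// ler_wpM2l ?powR_ge0//.
have [ti0|tiN0] := eqVneq (t i) 0; first by rewrite ti0 mul0r powR_ge0.
apply: ger1_powR => //; apply/andP; split.
  by rewrite divr_gt0// lt_def tiN0 t0.
rewrite ler_pdivrMr// mul1r /s big_mkord (bigD1 i)//= lerDl.
exact: sumr_ge0.
Qed.

Section reduction_to_finite_sums.
Context {R : realType} {X : normedModType R}.
Implicit Types (p : R) (alpha : R^nat).

Lemma gti_of_finite_sums p alpha :
  0 < p -> (forall i, 0 <= alpha i) ->
  (forall (t : R^nat) n, (forall i, 0 <= t i) ->
    (\sum_(0 <= i < n) t i) `^ p <= \sum_(0 <= i < n) alpha i * t i `^ p) ->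
  generalized_triangle_inequality X p alpha.
Proof.
move=> p0 a0 fin x cx.
have u0 i : (0 <= (alpha i * `|x i| `^ p)%:E)%E.
  by rewrite lee_fin mulr_ge0 ?powR_ge0.
split; first by apply: is_cvg_nneseries.
set S := (\sum_(0 <= i <oo) _)%E.
have S0 : (0 <= S)%E by apply: nneseries_ge0.
have bnd n : ((`|series x n| `^ p)%:E <= S)%E.
  apply: (@le_trans _ _ (\sum_(0 <= i < n) (alpha i * `|x i| `^ p)%:E)%E).
    rewrite sumEFin lee_fin.
    apply: le_trans (fin (fun i => `|x i|) n _) => //.
    apply: ge0_ler_powR; rewrite ?nnegrE ?sumr_ge0 ?(ltW p0)//.
    exact: ler_norm_sum.
  exact: nneseries_lim_ge.
case: S S0 bnd => [s|_ _|//]; last by rewrite leey.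
rewrite lee_fin => s0 bnd.
(* Taking [p]-th roots turns the bound into one on the norms themselves, so the limit passes without
   continuity of the power function. *)
have s'0 : 0 <= s `^ p^-1 by rewrite powR_ge0.
have -> : s = (s `^ p^-1) `^ p by rewrite -powRrM mulVf ?gt_eqF// powRr1.
have cn := @is_cvg_norm_sum _ _ _ cx.
rewrite lee_fin; apply: ge0_ler_powR; rewrite ?nnegrE ?(ltW p0)//.
  by apply: limr_ge => //; apply: nearW.
apply: limr_le => //; apply: nearW => n.
rewrite -[leLHS]powRr1// -[X in _ `^ X](mulfV (lt0r_neq0 p0)) powRrM.
by apply: ge0_ler_powR; rewrite ?nnegrE ?powR_ge0 ?invr_ge0 ?(ltW p0)// -lee_fin.
Qed.

Lemma finite_sums_of_gti p alpha (t : R^nat) (n : nat) :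
  (exists v : X, v != 0) -> 0 < p ->
  generalized_triangle_inequality X p alpha -> (forall i, 0 <= t i) ->
  (\sum_(0 <= i < n) t i) `^ p <= \sum_(0 <= i < n) alpha i * t i `^ p.
Proof.
move=> [v v0] p0 gti t0.
have nv0 : `|v| != 0 by rewrite normr_eq0.
(* All terms are nonnegative multiples of [v], so the triangle inequality is an equality; cutting
   off at [n] makes every series below eventually constant. *)
pose x : X^nat := fun i => (if (i < n)%N then t i / `|v| else 0) *: v.
have nx i : `|x i| = if (i < n)%N then t i else 0.
  rewrite /x normrZ; case: ifP => _; last by rewrite normr0 mul0r.
  by rewrite ger0_norm ?divr_ge0// divfK.
(* Generic in [V] because it serves sums in [X] as well as in [R]. *)
have trunc (V : nmodType) (F : nat -> V) m : (n <= m)%N ->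
    (forall i, (n <= i)%N -> F i = 0) ->
    \sum_(0 <= i < m) F i = \sum_(0 <= i < n) F i.
  move=> nm F0; rewrite (big_cat_nat _ nm)//= [X in _ + X]big_nat_cond.
  by rewrite [X in _ + X]big1 ?addr0// => i /andP[/andP[/F0]].
have x0 i : (n <= i)%N -> x i = 0.
  by rewrite /x leqNgt => /negbTE ->; rewrite scale0r.
have cx : cvgn [normed series x].
  apply: (@is_cvg_near_cst _ _ (\sum_(0 <= i < n) `|x i|)).
  exists n => // m /= nm; apply: trunc => // i /x0 ->; exact: normr0.
have [_] := gti x cx.
have -> : norm_sum x = \sum_(0 <= i < n) t i.
  apply: lim_near_cst => //; exists n => // m /= nm.
  rewrite /series/= trunc//.
  rewrite (@eq_big_nat _ _ _ _ _ _ (fun i => (t i / `|v|) *: v)); last first.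
    by move=> i /andP[_ ni]; rewrite /x ni.
  rewrite -scaler_suml normrZ -mulr_suml.
  by rewrite ger0_norm ?divr_ge0 ?sumr_ge0// divfK.
have -> : (\sum_(0 <= i <oo) (alpha i * `|x i| `^ p)%:E)%E
    = (\sum_(0 <= i < n) alpha i * t i `^ p)%:E.
  apply: lim_near_cst => //; exists n => // m /= nm.
  rewrite sumEFin trunc//; last first.
    by move=> i /x0 ->; rewrite normr0 powR0 ?gt_eqF// mulr0.
  congr (_%:E); apply: eq_big_nat => i /andP[_ ni]; by rewrite nx ni.
by rewrite lee_fin.
Qed.

Lemma gti_coef_ge1 p alpha i :
  (exists v : X, v != 0) -> 0 < p ->
  generalized_triangle_inequality X p alpha -> 1 <= alpha i.
Proof.
move=> Xn p0 gti.
have := @finite_sums_of_gti p alpha (fun j => (j == i)%:R) i.+1 Xn p0 gti.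
rewrite !big_nat_recr//= eqxx powR1 mulr1 !big_nat !big1 ?add0r ?powR1.
- by apply=> j; exact: ler0n.
- by move=> j /andP[_ /ltn_eqF ->]; rewrite powR0 ?gt_eqF// mulr0.
- by move=> j /andP[_ /ltn_eqF ->].
Qed.

End reduction_to_finite_sums.

Theorem theorem3p1 (R : realType) (X : normedModType R)
    (X_nontrivial : exists v : X, v != 0)
    (p : R) (p_gt0 : 0 < p) (alpha : R^nat) :
  (1 < p ->
     (generalized_triangle_inequality X p alpha <->
      (forall i, 0 < alpha i) /\
      (\sum_(0 <= i <oo) (alpha i `^ (1 / (1 - p)))%:E <= 1)%E)) /\
  (p <= 1 ->
     (generalized_triangle_inequality X p alpha <->
      forall i, 1 <= alpha i)).
Proof.
split=> p1; split.
- move=> gti.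
  have a0 i : 0 < alpha i.
    exact: lt_le_trans ltr01 (gti_coef_ge1 _ _ i X_nontrivial p_gt0 gti).
  split=> //; apply: lime_le.
    by apply: is_cvg_nneseries => i _ _; rewrite lee_fin powR_ge0.
  apply: nearW => n; rewrite sumEFin lee_fin.
  pose b i := alpha i `^ (1 / (1 - p)).
  have b0 i : 0 < b i by rewrite powR_gt0.
  (* The equality case of Hoelder: [alpha i * b i `^ p = b i]. *)
  have := finite_sums_of_gti _ _ _ n X_nontrivial p_gt0 gti (fun i => ltW (b0 i)).
  under [X in _ <= X]eq_bigr => i _.
    rewrite -{1}[alpha i](powRr1 (ltW (a0 i))) /b -powRrM -powRD; last first.
      by rewrite (lt0r_neq0 (a0 i)) implybT.
    rewrite (_ : 1 + 1 / (1 - p) * p = 1 / (1 - p)); last first.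
      by field; rewrite subr_eq0 lt_eqF.
    over.
  set s := \sum_(0 <= i < n) b i => sp.
  (* [sp] amounts to [s]^ p <= s[, whereas]1 < s[gives]ln s < p * ln s[, hence]s < s [^ p]. *)
  rewrite leNgt; apply/negP => s1; move: sp; apply/negP; rewrite -ltNge.
  rewrite -{1}[s]powRr1 ?(le_trans ler01 (ltW s1))//.
  by rewrite /powR gt_eqF ?(lt_trans ltr01)// ltr_expR ltr_pM2r ?ln_gt0.
- move=> [a0 a1].
  apply: gti_of_finite_sums => // [i|t n t0]; first exact: ltW.
  under [X in _ <= X]eq_bigr => i _.
    rewrite -{1}[alpha i](powRr1 (ltW (a0 i))).
    rewrite (_ : 1 = 1 / (1 - p) * (1 - p)); last first.
      by rewrite divfK// subr_eq0 lt_eqF.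
    rewrite powRrM; over.
  apply: powR_sum_weighted_le => //; first by move=> i; rewrite powR_gt0.
  rewrite -lee_fin -sumEFin; apply: le_trans a1.
  by apply: nneseries_lim_ge => i _ _; rewrite lee_fin powR_ge0.
- by move=> gti i; exact: gti_coef_ge1 _ _ _ X_nontrivial p_gt0 gti.
- move=> a1; have a0 i : 0 <= alpha i by exact: le_trans (a1 i).
  apply: gti_of_finite_sums => // t n t0.
  (* Subadditivity is the case of unit coefficients; larger ones only increase the right-hand
     side. *)
  apply: le_trans (powR_sum_le _ _ n _ p_gt0 p1 t0) _.
  by apply: ler_sum => i _; rewrite ler_peMl ?powR_ge0.
Qed.
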